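(* Among the $3$-dimensional complex multiplicative Hom-Lie superalgebras of superdimension $(2|1)$ listed in the classification of Wang, Zhang and Wei (the families $L^i_{2;1}$ described in the context), the complete ones are precisely $$L^{12,a}_{2;1}:\qquad [e_1,e_2]=e_1,\qquad [e_1,e_3]=e_3,\qquad \alpha=\begin{pmatrix}a&0&0\\0&1&0\\0&0&0\end{pmatrix},$$ where $a\in\mathbb{C}^{*}$ and $a^k\neq1$ for each integer $k\ge1$. Equivalently, $a$ is nonzero and not a root of unity.
   Context: All spaces are over $\mathbb{C}$. A multiplicative Hom-Lie superalgebra $(\mathfrak{g},[\cdot,\cdot],\alpha)$ is a $\mathbb{Z}_2$-graded space $\mathfrak{g}=\mathfrak{g}_{\bar0}\oplus\mathfrak{g}_{\bar1}$ with an even bilinear bracket and an even linear map $\alpha$ such that $\alpha([x,y])=[\alpha(x),\alpha(y)]$ and, for homogeneous $x,y,z$: $[x,y]=-(-1)^{|x||y|}[y,x]$ and $\sum_{\circlearrowleft_{x,y,z}}(-1)^{|x||z|}[\alpha(x),[y,z]]=0$ (cyclic sum). The center is $C(\mathfrak{g})=\{x:[x,\mathfrak{g}]=0\}$. With $\alpha^0=\mathrm{id}$, an $\alpha^k$-derivation is a homogeneous linear map $D$ of parity $|D|$ with $D\alpha=\alpha D$ and $D([x,y])=[D(x),\alpha^k(y)]+(-1)^{|D||x|}[\alpha^k(x),D(y)]$ for homogeneous $x,y$; $\operatorname{Der}_{\alpha^k}(\mathfrak{g})$ is the direct sum of the spaces of even and odd ones. For homogeneous $x$ with $\alpha(x)=x$,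 put $\operatorname{ad}_x^k(y)=[x,\alpha^k(y)]$; $\operatorname{Inn}_{\alpha^k}(\mathfrak{g})$ is the span of these maps. $\mathfrak{g}$ is complete if $C(\mathfrak{g})=\{0\}$ and $\operatorname{Der}_{\alpha^{k+1}}(\mathfrak{g})=\operatorname{Inn}_{\alpha^k}(\mathfrak{g})$ for every integer $k\ge0$. Throughout, $\mathfrak{g}_{\bar0}=\operatorname{span}\{e_1,e_2\}$, $\mathfrak{g}_{\bar1}=\operatorname{span}\{e_3\}$; matrices act by columns; brackets of basis elements not listed and not determined by super-skew-symmetry are zero. The list consists of the following families. (A) Families with nonzero center: $L^2_{2;1}$ (center $\mathfrak{g}$); $L^3_{2;1}$ (center $\operatorname{span}\{e_1,e_2\}$); $L^4_{2;1},L^5_{2;1}$ (center $\operatorname{span}\{e_3\}$); $L^7_{2;1},L^8_{2;1},L^{13}_{2;1},L^{14}_{2;1},L^{15}_{2;1}$ (center $\operatorname{span}\{e_1\}$); $L^{21}_{2;1},L^{22}_{2;1}$ (center $\operatorname{span}\{e_2\}$). (B) The remaining families: $L^6_{2;1}$: $[e_1,e_2]=e_1$, $[e_3,e_3]=e_1$; $\alpha(e_1)=0$, $\alpha(e_2)=e_1$, $\alpha(e_3)=0$. $L^{9,a}_{2;1}$ ($a\ne0$): $[e_1,e_2]=e_1$, $[e_3,e_3]=e_2$; $\alpha(e_1)=0$, $\alpha(e_2)=a^2e_2$, $\alpha(e_3)=ae_3$. With bracket $[e_1,e_2]=e_1$, $[e_1,e_3]=e_3$: $L^{10}_{2;1}$: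 $\alpha(e_1)=0$, $\alpha(e_2)=e_2$, $\alpha(e_3)=0$; $L^{11,a}_{2;1}$ ($a\neq1$): $\alpha(e_1)=0$, $\alpha(e_2)=ae_2$, $\alpha(e_3)=0$; $L^{12,a}_{2;1}$ ($a\ne1$): $\alpha(e_1)=ae_1$, $\alpha(e_2)=e_2$, $\alpha(e_3)=0$. With bracket $[e_1,e_2]=\gamma e_1$, $[e_2,e_3]=\lambda e_3$, $\gamma\lambda\neq0$: $L^{16,a}_{2;1}$ ($a\ne0$): $\alpha(e_1)=0$, $\alpha(e_2)=e_2$, $\alpha(e_3)=ae_3$; $L^{17}_{2;1}$: $\alpha(e_1)=0$, $\alpha(e_2)=e_2$, $\alpha(e_3)=0$; $L^{18,a,b}_{2;1}$ ($b\neq1$): $\alpha(e_1)=0$, $\alpha(e_2)=ae_1+be_2$, $\alpha(e_3)=0$; $L^{19,a,b}_{2;1}$ ($a\ne0$): $\alpha(e_1)=ae_1$, $\alpha(e_2)=be_1+e_2$, $\alpha(e_3)=0$; $L^{20,a,b,c}_{2;1}$ ($ac\neq0$): $\alpha(e_1)=ae_1$, $\alpha(e_2)=be_1+e_2$, $\alpha(e_3)=ce_3$. $L^{23}_{2;1}$: $[e_1,e_2]=\gamma e_1$, $[e_2,e_3]=\lambda e_3$, $[e_3,e_3]=\mu e_1$, $\gamma\lambda\mu\ne0$; $\alpha(e_1)=0$, $\alpha(e_2)=e_1$, $\alpha(e_3)=0$. *)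

(* Defs.v *)
From HB Require Import structures.
From mathcomp Require Import all_boot all_order all_algebra.
From mathcomp Require Import ring.

Set Implicit Arguments.
Unset Strict Implicit.
Unset Printing Implicit Defensive.

Import GRing.Theory.
Local Open Scope ring_scope.

Section HomLieSuperalgebras.
Variables (F : fieldType) (V : vectType F).

(* Parities are booleans: [false] is the even part, [true] the odd part, and
   [(+)] is addition of parities.  The type of [br] makes the bracket bilinear
   by construction: [br g x y] is the bracket of [x] and [y]. *)
Record homSuperalgebra := HomSuperalgebra {
  part : bool -> {vspace V};
  br : 'Hom(V, 'End(V));
  twist : 'End(V)
}.

Implicit Types (g : homSuperalgebra) (D : 'End(V)).

Definition has_parity g (d : bool) D : Prop :=
  forall i x, x \in part g i -> D x \in part g (d (+) i).

Record multHomLie g : Prop := MultHomLie {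
  part_direct : directv (part g false + part g true);
  part_full : (part g false + part g true)%VS = fullv;
  br_even : forall i j x y, x \in part g i -> y \in part g j ->
    br g x y \in part g (i (+) j);
  twist_even : has_parity g false (twist g);
  twist_br : forall x y, twist g (br g x y) = br g (twist g x) (twist g y);
  br_skew : forall (i j : bool) x y, x \in part g i -> y \in part g j ->
    br g x y = - ((-1) ^+ (i * j) *: br g y x);
  hom_jacobi : forall (i j k : bool) x y z,
    x \in part g i -> y \in part g j -> z \in part g k ->
    (-1) ^+ (i * k) *: br g (twist g x) (br g y z)
    + (-1) ^+ (j * i) *: br g (twist g y) (br g z x)
    + (-1) ^+ (k * j) *: br g (twist g z) (br g x y) = 0
}.

Definition center g : {vspace V} := lker (br g).

Lemma centerP g x : reflect (forall y, br g x y = 0) (x \in center g).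
Proof.
rewrite memv_ker; apply: (iffP eqP) => [-> y|x0]; first by rewrite lfunE.
by apply/lfunP => y; rewrite x0 lfunE.
Qed.

Definition twistX g (k : nat) : 'End(V) :=
  iter k (fun f => (twist g \o f)%VF) \1%VF.

Lemma twistXE g k x : twistX g k x = iter k (twist g) x.
Proof.
by elim: k => [|k IHk]; rewrite ?id_lfunE //= comp_lfunE -IHk.
Qed.

Definition alpha_derivation g (k : nat) (d : bool) D : Prop :=
  [/\ has_parity g d D,
      forall x, D (twist g x) = twist g (D x) &
      forall (i j : bool) x y, x \in part g i -> y \in part g j ->
        D (br g x y) = br g (D x) (twistX g k y)
                       + (-1) ^+ (d * i) *: br g (twistX g k x) (D y)].

Definition Der g (k : nat) D : Prop :=
  exists D0 D1, [/\ alpha_derivation g k false D0,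
                    alpha_derivation g k true D1 & D = D0 + D1].

Definition ad g (k : nat) (x : V) : 'End(V) := (br g x \o twistX g k)%VF.

Definition Inn g (k : nat) D : Prop :=
  exists2 s : seq V,
    forall x, x \in s -> (exists i, x \in part g i) /\ twist g x = x &
    D \in <<[seq ad g k x | x <- s]>>%VS.

Definition complete g : Prop :=
  center g = 0%VS /\ forall k D, Der g k.+1 D <-> Inn g k D.

End HomLieSuperalgebras.

Section Classification.
Variable F : fieldType.
Notation V := 'cV[F]_3.

Definition e1 : V := delta_mx 0 0.
Definition e2 : V := delta_mx 1 0.
Definition e3 : V := delta_mx 2 0.

Definition std_part (i : bool) : {vspace V} :=
  if i then <<[:: e3]>>%VS else <<[:: e1; e2]>>%VS.

Definition br_fun (b12 b13 b23 b33 x y : V) : V :=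
  (x 0 0 * y 1 0 - x 1 0 * y 0 0) *: b12
  + (x 0 0 * y 2 0 - x 2 0 * y 0 0) *: b13
  + (x 1 0 * y 2 0 - x 2 0 * y 1 0) *: b23
  + (x 2 0 * y 2 0) *: b33.

Definition twist_fun (a1 a2 a3 x : V) : V :=
  x 0 0 *: a1 + x 1 0 *: a2 + x 2 0 *: a3.

Fact br_fun_linear b12 b13 b23 b33 x : linear (br_fun b12 b13 b23 b33 x).
Proof. by move=> c u v; apply/colP => i; rewrite /br_fun !mxE; ring. Qed.

HB.instance Definition _ b12 b13 b23 b33 x :=
  GRing.isLinear.Build F V V *:%R (br_fun b12 b13 b23 b33 x)
    (br_fun_linear b12 b13 b23 b33 x).

Definition br_lfun b12 b13 b23 b33 x : 'End(V) :=
  linfun (br_fun b12 b13 b23 b33 x).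

Fact br_lfun_linear b12 b13 b23 b33 : linear (br_lfun b12 b13 b23 b33).
Proof.
move=> c u v; apply/lfunP => w; rewrite add_lfunE scale_lfunE !lfunE /=.
by apply/colP => i; rewrite /br_fun !mxE; ring.
Qed.

HB.instance Definition _ b12 b13 b23 b33 :=
  GRing.isLinear.Build F V 'End(V) *:%R (br_lfun b12 b13 b23 b33)
    (br_lfun_linear b12 b13 b23 b33).

Fact twist_fun_linear a1 a2 a3 : linear (twist_fun a1 a2 a3).
Proof. by move=> c u v; apply/colP => i; rewrite /twist_fun !mxE; ring. Qed.

HB.instance Definition _ a1 a2 a3 :=
  GRing.isLinear.Build F V V *:%R (twist_fun a1 a2 a3)
    (twist_fun_linear a1 a2 a3).

(* The structure on F^(2|1) with [e1,e2] = b12, [e1,e3] = b13, [e2,e3] = b23,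
   [e3,e3] = b33, completed by super-skew-symmetry (so [e1,e1] = [e2,e2] = 0),
   and with the twist sending e1, e2, e3 to a1, a2, a3. *)
Definition algebra21 (b12 b13 b23 b33 a1 a2 a3 : V) : homSuperalgebra V :=
  HomSuperalgebra std_part
    (linfun (br_lfun b12 b13 b23 b33))
    (linfun (twist_fun a1 a2 a3)).

Lemma algebra21_brE b12 b13 b23 b33 a1 a2 a3 x y :
  br (algebra21 b12 b13 b23 b33 a1 a2 a3) x y = br_fun b12 b13 b23 b33 x y.
Proof. by rewrite !lfunE. Qed.

Lemma algebra21_twistE b12 b13 b23 b33 a1 a2 a3 x :
  twist (algebra21 b12 b13 b23 b33 a1 a2 a3) x = twist_fun a1 a2 a3 x.
Proof. by rewrite lfunE. Qed.

Lemma std_partP (i : bool) (x : V) : reflect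
  (if i then x 0 0 = 0 /\ x 1 0 = 0 else x 2 0 = 0) (x \in std_part i).
Proof.
have xE : x = x 0 0 *: e1 + x 1 0 *: e2 + x 2 0 *: e3.
  apply/colP => j; rewrite !mxE.
  by case: j => -[|[|[|//]]] j3 /=; rewrite ?(mulr0, mulr1, addr0, add0r);
    congr (x _ _); apply: val_inj.
apply: (iffP idP); case: i => /=.
- by rewrite span_seq1 => /vlineP[k ->]; rewrite !mxE !mulr0.
- rewrite span_cons span_seq1 => /memv_addP[u /vlineP[k ->] [v /vlineP[l ->] ->]].
  by rewrite !mxE !mulr0 addr0.
- case=> x0 x1; rewrite xE x0 x1 !scale0r !add0r span_seq1.
  by rewrite rpredZ ?memv_line.
- move=> x2; rewrite xE x2 scale0r addr0.
  by rewrite rpredD ?rpredZ ?memv_span ?inE ?eqxx ?orbT.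
Qed.

Definition L6 := algebra21 e1 0 0 e1 0 e1 0.
Definition L9 (a : F) := algebra21 e1 0 0 e2 0 (a ^+ 2 *: e2) (a *: e3).
Definition L10 := algebra21 e1 e3 0 0 0 e2 0.
Definition L11 (a : F) := algebra21 e1 e3 0 0 0 (a *: e2) 0.
Definition L12 (a : F) := algebra21 e1 e3 0 0 (a *: e1) e2 0.
Definition L16 (gam lam a : F) :=
  algebra21 (gam *: e1) 0 (lam *: e3) 0 0 e2 (a *: e3).
Definition L17 (gam lam : F) :=
  algebra21 (gam *: e1) 0 (lam *: e3) 0 0 e2 0.
Definition L18 (gam lam a b : F) :=
  algebra21 (gam *: e1) 0 (lam *: e3) 0 0 (a *: e1 + b *: e2) 0.
Definition L19 (gam lam a b : F) :=
  algebra21 (gam *: e1) 0 (lam *: e3) 0 (a *: e1) (b *: e1 + e2) 0.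
Definition L20 (gam lam a b c : F) :=
  algebra21 (gam *: e1) 0 (lam *: e3) 0 (a *: e1) (b *: e1 + e2) (c *: e3).
Definition L23 (gam lam mu : F) :=
  algebra21 (gam *: e1) 0 (lam *: e3) (mu *: e1) 0 e1 0.

Definition with_center (Z : {vspace V}) (g : homSuperalgebra V) : Prop :=
  [/\ multHomLie g, part g = std_part & center g = Z].

(* The families with nonzero center enter only through their center, so they
   are represented by all multiplicative Hom-Lie superalgebra structures on
   F^(2|1) (with the standard grading) having that center. *)
Inductive listed : homSuperalgebra V -> Prop :=
| In_L2 g of with_center fullv g : listed g
| In_L3 g of with_center <<[:: e1; e2]>>%VS g : listed g
| In_L4_L5 g of with_center <[e3]>%VS g : listed g
| In_L7_L8_L13_L14_L15 g of with_center <[e1]>%VS g : listed g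
| In_L21_L22 g of with_center <[e2]>%VS g : listed g
| In_L6 : listed L6
| In_L9 a of a != 0 : listed (L9 a)
| In_L10 : listed L10
| In_L11 a of a != 1 : listed (L11 a)
| In_L12 a of a != 1 : listed (L12 a)
| In_L16 gam lam a of gam * lam != 0 & a != 0 : listed (L16 gam lam a)
| In_L17 gam lam of gam * lam != 0 : listed (L17 gam lam)
| In_L18 gam lam a b of gam * lam != 0 & b != 1 : listed (L18 gam lam a b)
| In_L19 gam lam a b of gam * lam != 0 & a != 0 : listed (L19 gam lam a b)
| In_L20 gam lam a b c of gam * lam != 0 & a * c != 0 :
    listed (L20 gam lam a b c)
| In_L23 gam lam mu of gam * lam * mu != 0 : listed (L23 gam lam mu).

Fact algebra21_multHomLie (p q r s t A B D E : F) :
  [/\ p * A = A * D * p, q * E = A * E * q & r * E = E * (B * q + D * r)] ->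
  s * A + t * B = E ^+ 2 * s /\ t * D = E ^+ 2 * t ->
  [/\ A * r * q - q * (B * q + D * r) - p * q * E = 0,
      A * t * p = 2%:R * E * q * s, E * q * t = 0 & E * r * t = 0] ->
  p * (B * t - D * s) = 2%:R * E * r * s /\ E * (s * q + t * r) = 0 ->
  multHomLie (algebra21 (p *: e1) (q *: e3) (r *: e3) (s *: e1 + t *: e2)
                        (A *: e1) (B *: e1 + D *: e2) (E *: e3)).
Proof.
case=> m1 m2 m3 [m4 m5] [j1 j2 j3 j4] [j5 j6].
set h := algebra21 _ _ _ _ _ _ _.
have hP i (x : V) : x \in part h i ->
    if i then x 0 0 = 0 /\ x 1 0 = 0 else x 2 0 = 0 by move/std_partP.
have inP i (x : V) : (if i then x 0 0 = 0 /\ x 1 0 = 0 else x 2 0 = 0) ->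
    x \in part h i by move/std_partP.
have br0 x y : br h x y 0 0 =
    (x 0 0 * y 1 0 - x 1 0 * y 0 0) * p + x 2 0 * y 2 0 * s.
  by rewrite algebra21_brE !mxE /=; ring.
have br1 x y : br h x y 1 0 = x 2 0 * y 2 0 * t.
  by rewrite algebra21_brE !mxE /=; ring.
have br2 x y : br h x y 2 0 = (x 0 0 * y 2 0 - x 2 0 * y 0 0) * q
    + (x 1 0 * y 2 0 - x 2 0 * y 1 0) * r.
  by rewrite algebra21_brE !mxE /=; ring.
have tw0 x : twist h x 0 0 = x 0 0 * A + x 1 0 * B.
  by rewrite algebra21_twistE !mxE /=; ring.
have tw1 x : twist h x 1 0 = x 1 0 * D.
  by rewrite algebra21_twistE !mxE /=; ring.
have tw2 x : twist h x 2 0 = x 2 0 * E.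
  by rewrite algebra21_twistE !mxE /=; ring.
have eqV (x y : V) : x 0 0 = y 0 0 -> x 1 0 = y 1 0 -> x 2 0 = y 2 0 -> x = y.
  move=> c0 c1 c2; apply/colP => -[[|[|[|//]]] k3];
  [move: c0|move: c1|move: c2]; congr (x _ _ = y _ _); exact: val_inj.
have coE := (br0, br1, br2, tw0, tw1, tw2).
split.
- apply/directv_addP/eqP; rewrite -subv0; apply/subvP => x.
  rewrite memv_cap => /andP[/(hP false) x2 /(hP true) [x0 x1]].
  by rewrite memv0; apply/eqP/eqV; rewrite ?(x0, x1, x2) mxE.
- apply/eqP; rewrite eqEsubv subvf; apply/subvP => x _.
  rewrite -[x](subrK (x 2 0 *: e3)); apply: memv_add; apply: inP;
    by rewrite !mxE /= ?mulr0 ?mulr1 ?subrr.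
- move=> [] [] x y /hP px /hP py; apply: inP; rewrite /= !coE.
  + by case: px py => -> -> [-> ->]; ring.
  + by case: px => -> ->; rewrite py; split; ring.
  + by case: py => -> ->; rewrite px; split; ring.
  + by rewrite px py; ring.
- move=> [] x /hP px; apply: inP; rewrite /= !coE.
    by case: px => -> ->; split; ring.
  by rewrite px; ring.
- move=> x y.
  pose l := x 0 0 * y 1 0 - x 1 0 * y 0 0.
  pose m := x 0 0 * y 2 0 - x 2 0 * y 0 0.
  pose n := x 1 0 * y 2 0 - x 2 0 * y 1 0; pose k := x 2 0 * y 2 0.
  apply: eqV; rewrite !coE.
  + transitivity (l * (p * A) + k * (s * A + t * B)); first by rewrite /l /k; ring.
    by rewrite m1 m4 /l /k; ring.
  + by rewrite -mulrA m5; ring.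
  + transitivity (m * (q * E) + n * (r * E)); first by rewrite /m /n; ring.
    by rewrite m2 m3 /m /n; ring.
- move=> [] [] x y /hP px /hP py; apply: eqV; rewrite !mxE !coE /=.
  1-3: by case: px py => p0 p1 [q0 q1]; rewrite ?(p0, p1, q0, q1); ring.
  1-3: by case: px => p0 p1; rewrite ?(p0, p1, py); ring.
  1-3: by case: py => p0 p1; rewrite ?(p0, p1, px); ring.
  1-3: by rewrite ?(px, py); ring.
- have sgE (i j : bool) : (-1) ^+ (i * j) = (if i && j then -1 else 1) :> F.
    by case: i; case: j.
  move=> i j k x y z /hP px /hP py /hP pz; apply: eqV; rewrite !sgE !mxE !coE.
  all: move: (x 0 0) (x 1 0) (x 2 0) (y 0 0) (y 1 0) (y 2 0) (z 0 0) (z 1 0) (z 2 0)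
    px py pz => x0 x1 x2 y0 y1 y2 z0 z1 z2.
  all: case: i; case: j; case: k => /=.
  all: repeat (let h := fresh "h" in let k := fresh "h" in match goal with |- _ = 0 -> _ => move=> h; rewrite ?{}h | |- _ /\ _ -> _ => case=> h k; rewrite ?{}h ?{}k end).
  all: try ring.
  all: pose J1 := A * r * q - q * (B * q + D * r) - p * q * E.
  all: pose J2 (u v : F) := u * (A * t * p - 2%:R * E * q * s)
         + v * (p * (B * t - D * s) - 2%:R * E * r * s).
  all: pose J3 (u v : F) := u * (E * q * t) + v * (E * r * t).
  all: have J1E : J1 = 0 by [].
  all: have J2E u v : J2 u v = 0 by rewrite /J2 j2 j5 !subrr !mulr0 addr0.
  all: have J3E u v : J3 u v = 0 by rewrite /J3 j3 j4 !mulr0 addr0.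
  all: first
    [ by transitivity (3%:R * x2 * y2 * z2 * (E * (s * q + t * r))); [ring | rewrite j6; ring]
    | by transitivity ((x0 * y1 - x1 * y0) * z2 * J1); [rewrite /J1; ring | rewrite J1E mulr0]
    | by transitivity ((y0 * z1 - y1 * z0) * x2 * J1); [rewrite /J1; ring | rewrite J1E mulr0]
    | by transitivity ((z0 * x1 - z1 * x0) * y2 * J1); [rewrite /J1; ring | rewrite J1E mulr0]
    | by transitivity (x2 * y2 * J2 z0 z1); [rewrite /J2; ring | rewrite J2E mulr0]
    | by transitivity (y2 * z2 * J2 x0 x1); [rewrite /J2; ring | rewrite J2E mulr0]
    | by transitivity (z2 * x2 * J2 y0 y1); [rewrite /J2; ring | rewrite J2E mulr0]
    | by transitivity (- 2%:R * x2 * y2 * J3 z0 z1); [rewrite /J3; ring | rewrite J3E mulr0]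
    | by transitivity (- 2%:R * y2 * z2 * J3 x0 x1); [rewrite /J3; ring | rewrite J3E mulr0]
    | by transitivity (- 2%:R * z2 * x2 * J3 y0 y1); [rewrite /J3; ring | rewrite J3E mulr0]
    | match goal with |- ?G => idtac "FAIL" G end ].
Qed.

Lemma listed_multHomLie g : listed g -> multHomLie g.
Proof.
case=> {g} [g []//|g []//|g []//|g []//|g []//||a _||a _|a _|gam lam a _ _|gam lam _|gam lam a b _ _|gam lam a b _ _|gam lam a b c _ _|gam lam mu _].
- have := @algebra21_multHomLie 1 0 0 1 0 0 1 0 0.
  by rewrite ?(scale0r, scale1r, addr0, add0r); apply; split; ring.
- have := @algebra21_multHomLie 1 0 0 0 1 0 0 (a ^+ 2) a.
  by rewrite ?(scale0r, scale1r, addr0, add0r); apply; split; ring.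
- have := @algebra21_multHomLie 1 1 0 0 0 0 0 1 0.
  by rewrite ?(scale0r, scale1r, addr0, add0r); apply; split; ring.
- have := @algebra21_multHomLie 1 1 0 0 0 0 0 a 0.
  by rewrite ?(scale0r, scale1r, addr0, add0r); apply; split; ring.
- have := @algebra21_multHomLie 1 1 0 0 0 a 0 1 0.
  by rewrite ?(scale0r, scale1r, addr0, add0r); apply; split; ring.
- have := @algebra21_multHomLie gam 0 lam 0 0 0 0 1 a.
  by rewrite ?(scale0r, scale1r, addr0, add0r); apply; split; ring.
- have := @algebra21_multHomLie gam 0 lam 0 0 0 0 1 0.
  by rewrite ?(scale0r, scale1r, addr0, add0r); apply; split; ring.
- have := @algebra21_multHomLie gam 0 lam 0 0 0 a b 0.
  by rewrite ?(scale0r, scale1r, addr0, add0r); apply; split; ring.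
- have := @algebra21_multHomLie gam 0 lam 0 0 a b 1 0.
  by rewrite ?(scale0r, scale1r, addr0, add0r); apply; split; ring.
- have := @algebra21_multHomLie gam 0 lam 0 0 a b 1 c.
  by rewrite ?(scale0r, scale1r, addr0, add0r); apply; split; ring.
- have := @algebra21_multHomLie gam 0 lam mu 0 0 1 0 0.
  by rewrite ?(scale0r, scale1r, addr0, add0r); apply; split; ring.
Qed.

Definition is_root_of_unity (a : F) : Prop :=
  exists2 n, (0 < n)%N & n.-unity_root a.

End Classification.

(* Main.v *)
Require Import Defs.
From mathcomp Require Import all_boot all_order all_algebra.
From mathcomp Require Import reals.
From mathcomp.real_closed Require Import complex.
From mathcomp Require Import ring.

Set Implicit Arguments.
Unset Strict Implicit.
Unset Printing Implicit Defensive.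

Import GRing.Theory.
Local Open Scope ring_scope.

(** A nonzero center excludes completeness at once, so the work is in the
    families with explicit brackets. There completeness fails because some
    derivation of level k+1 is not inner of level k, for the following reasons.

    - If the twist kills e1 and e3, and no bracket has an e2-component, then
      every even endomorphism that is supported on e2 and commutes with the
      twist is a derivation of level 1. When the twist fixes no nonzero vector
      there are no inner maps, so any such endomorphism, if nonzero, is an
      obstruction ([no_fixed_point_incomplete]). When the twist is
      diag(0, 1, 0), the obstruction is the projection to e2, because inner
      maps take values in the brackets ([twist_diag010_incomplete]).
    - In the algebra [L9 a], inner maps never reach e3, while the grading that
      gives e3 weight 1 and e2 the matching weight 2a is a derivation.
    - If e1 and e3 are weight vectors for e2, with a nonzero weight on e1, and
      the twist fixes e2 modulo e1, then the projection to e3 is a derivation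
      of level 1. An inner map of level 0 cannot scale e3 without also scaling
      e1, since both factors come from the action of e2
      ([e1_weight_incomplete]).
    - In [L12 a], the projection to e3 is a derivation of level n as soon as
      a ^+ n = 1, while for n > 1 every inner map of level n - 1 kills e3
      ([L12_root_of_unity_incomplete]).

    When a is nonzero and not a root of unity, an endomorphism commuting with
    the twist diag(a, 1, 0) is diagonal, because the three eigenvalues are
    distinct. The Leibniz rule on [e1, e2] and on [e1, e3] then kills its e2-
    and e3-entries ([L12_Der]). What remains is the line of the projection to
    e1, which is also the line spanned by the inner map of e2, the only fixed
    vector up to scaling ([L12_Inn]). Hence derivations and inner maps agree. *)

(** * Derivations and inner maps in general *)
Section DerivationsAndInnerMaps.
Variables (F : fieldType) (V : vectType F).
Implicit Types (g : homSuperalgebra V) (D : 'End(V)).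

(** On an even map the sign of the Leibniz rule disappears, so the rule can be
    checked on arbitrary vectors instead of homogeneous ones. *)
Lemma even_map_Der g k D :
    has_parity g false D ->
    (forall x, D (twist g x) = twist g (D x)) ->
    (forall x y, D (br g x y) =
       br g (D x) (twistX g k y) + br g (twistX g k x) (D y)) ->
  Der g k D.
Proof.
move=> evD comD derD; exists D, 0; rewrite addr0; split=> //.
  by split=> // i j x y _ _; rewrite mul0n scale1r derD.
split=> [i x _|x|i j x y _ _]; rewrite ?zero_lfunE ?mem0v ?linear0 //.
by rewrite zero_lfunE addr0.
Qed.

(** A linear condition that holds for the maps ad_x of the homogeneous fixed
    vectors x holds for all inner maps: this is how a map is shown not to be
    inner. *)
Lemma Inn_ind g k (P : 'End(V) -> Prop) :
    P 0 -> (forall c D E, P D -> P E -> P (c *: D + E)) ->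
    (forall i x, x \in part g i -> twist g x = x -> P (ad g k x)) ->
  forall D, Inn g k D -> P D.
Proof.
move=> P0 PZD Pad D [s fix_s].
elim: s D fix_s => [|x s IHs] D fix_s /=.
  by rewrite span_nil memv0 => /eqP->.
rewrite span_cons => /memv_addP[_ /vlineP[c ->] [E /IHs PE ->]].
have [[i xi] fx] := fix_s x (mem_head x s).
apply: PZD; first exact: Pad xi fx.
by apply: PE => y ys; apply: fix_s; rewrite inE ys orbT.
Qed.

Lemma complete_Der_Inn g k D : complete g -> Der g k.+1 D -> Inn g k D.
Proof. by case=> _ /(_ k D)[]. Qed.

End DerivationsAndInnerMaps.

(** * A common model for the listed algebras *)
Section Models.
Variable F : fieldType.
Notation V := 'cV[F]_3.
Implicit Types (x y v : V) (a p q r s t A B D E : F).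

Lemma col3_eq x y : x 0 0 = y 0 0 -> x 1 0 = y 1 0 -> x 2 0 = y 2 0 -> x = y.
Proof.
move=> c0 c1 c2; apply/colP => -[[|[|[|//]]] k3];
  [move: c0|move: c1|move: c2]; congr (x _ _ = y _ _); exact: val_inj.
Qed.

(** Locked, like [model] below, so that rewriting with coordinate rules never
    identifies this map with the twist of an algebra, which unfolds to the same
    term. *)
Definition endo_of_cols v1 v2 v3 : 'End(V) :=
  locked (linfun (twist_fun v1 v2 v3)).

(** All the explicit families of the classification are specializations of this
    one, so that their coordinates can be computed once. *)
Definition model p q r s t A B D E : homSuperalgebra V :=
  locked (algebra21 (p *: e1 F) (q *: e3 F) (r *: e3 F) (s *: e1 F + t *: e2 F)
                    (A *: e1 F) (B *: e1 F + D *: e2 F) (E *: e3 F)).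

Section Coordinates.
Variables p q r s t A B D E : F.
Notation g := (model p q r s t A B D E).

Lemma model_br0 x y : br g x y 0 0 =
  (x 0 0 * y 1 0 - x 1 0 * y 0 0) * p + x 2 0 * y 2 0 * s.
Proof. by rewrite /model -lock algebra21_brE !mxE /=; ring. Qed.

Lemma model_br1 x y : br g x y 1 0 = x 2 0 * y 2 0 * t.
Proof. by rewrite /model -lock algebra21_brE !mxE /=; ring. Qed.

Lemma model_br2 x y : br g x y 2 0 = (x 0 0 * y 2 0 - x 2 0 * y 0 0) * q
  + (x 1 0 * y 2 0 - x 2 0 * y 1 0) * r.
Proof. by rewrite /model -lock algebra21_brE !mxE /=; ring. Qed.

Lemma model_twist0 x : twist g x 0 0 = x 0 0 * A + x 1 0 * B.
Proof. by rewrite /model -lock algebra21_twistE !mxE /=; ring. Qed.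

Lemma model_twist1 x : twist g x 1 0 = x 1 0 * D.
Proof. by rewrite /model -lock algebra21_twistE !mxE /=; ring. Qed.

Lemma model_twist2 x : twist g x 2 0 = x 2 0 * E.
Proof. by rewrite /model -lock algebra21_twistE !mxE /=; ring. Qed.

Lemma model_partP i x : reflect
  (if i then x 0 0 = 0 /\ x 1 0 = 0 else x 2 0 = 0) (x \in part g i).
Proof. by rewrite /model -lock; apply: std_partP. Qed.

Lemma endo_of_cols_coord v1 v2 v3 x i : endo_of_cols v1 v2 v3 x i 0 =
  x 0 0 * v1 i 0 + x 1 0 * v2 i 0 + x 2 0 * v3 i 0.
Proof. by rewrite /endo_of_cols -lock lfunE !mxE. Qed.

Lemma endo_of_cols_even v1 v2 v3 : v1 2 0 = 0 -> v2 2 0 = 0 ->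
  v3 0 0 = 0 -> v3 1 0 = 0 -> has_parity g false (endo_of_cols v1 v2 v3).
Proof.
move=> v12 v22 v30 v31 [] x /model_partP xP; apply/model_partP => /=;
  rewrite !endo_of_cols_coord.
  by case: xP => -> ->; rewrite v30 v31; split; ring.
by rewrite xP v12 v22; ring.
Qed.

End Coordinates.

Lemma e1_coord i : e1 F i 0 = (i == 0)%:R. Proof. by rewrite mxE andbT. Qed.
Lemma e2_coord i : e2 F i 0 = (i == 1)%:R. Proof. by rewrite mxE andbT. Qed.
Lemma e3_coord i : e3 F i 0 = (i == 2)%:R. Proof. by rewrite mxE andbT. Qed.
Lemma colD_coord x y i : (x + y) i 0 = x i 0 + y i 0. Proof. exact: mxE. Qed.
Lemma colZ_coord a x i : (a *: x) i 0 = a * x i 0. Proof. exact: mxE. Qed.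
Lemma col0_coord i : (0 : V) i 0 = 0. Proof. exact: mxE. Qed.

Definition coordE := (model_br0, model_br1, model_br2,
  model_twist0, model_twist1, model_twist2, endo_of_cols_coord,
  e1_coord, e2_coord, e3_coord, colD_coord, colZ_coord, col0_coord).

Lemma endo_eq (f h : 'End(V)) :
  f (e1 F) = h (e1 F) -> f (e2 F) = h (e2 F) -> f (e3 F) = h (e3 F) -> f = h.
Proof.
move=> f1 f2 f3; apply/lfunP => x.
have -> : x = x 0 0 *: e1 F + x 1 0 *: e2 F + x 2 0 *: e3 F.
  by apply: col3_eq; rewrite !coordE /=; ring.
by rewrite !linearD !linearZ /= f1 f2 f3.
Qed.

Lemma mulr_fixed_eq0 a u : a != 1 -> u * a = u -> u = 0.
Proof.
move=> a1 /eqP; rewrite -subr_eq0 -[X in _ - X]mulr1 -mulrBr mulf_eq0 subr_eq0.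
by rewrite (negPf a1) orbF => /eqP.
Qed.

Lemma L6_model : L6 F = model 1 0 0 1 0 0 1 0 0.
Proof. by rewrite /model -lock ?(scale0r, scale1r, addr0, add0r). Qed.
Lemma L9_model a : L9 a = model 1 0 0 0 1 0 0 (a ^+ 2) a.
Proof. by rewrite /model -lock ?(scale0r, scale1r, addr0, add0r). Qed.
Lemma L10_model : L10 F = model 1 1 0 0 0 0 0 1 0.
Proof. by rewrite /model -lock ?(scale0r, scale1r, addr0, add0r). Qed.
Lemma L11_model a : L11 a = model 1 1 0 0 0 0 0 a 0.
Proof. by rewrite /model -lock ?(scale0r, scale1r, addr0, add0r). Qed.
Lemma L12_model a : L12 a = model 1 1 0 0 0 a 0 1 0.
Proof. by rewrite /model -lock ?(scale0r, scale1r, addr0, add0r). Qed.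
Lemma L16_model p r a : L16 p r a = model p 0 r 0 0 0 0 1 a.
Proof. by rewrite /model -lock ?(scale0r, scale1r, addr0, add0r). Qed.
Lemma L17_model p r : L17 p r = model p 0 r 0 0 0 0 1 0.
Proof. by rewrite /model -lock ?(scale0r, scale1r, addr0, add0r). Qed.
Lemma L18_model p r a b : L18 p r a b = model p 0 r 0 0 0 a b 0.
Proof. by rewrite /model -lock ?(scale0r, scale1r, addr0, add0r). Qed.
Lemma L19_model p r a b : L19 p r a b = model p 0 r 0 0 a b 1 0.
Proof. by rewrite /model -lock ?(scale0r, scale1r, addr0, add0r). Qed.
Lemma L20_model p r a b c : L20 p r a b c = model p 0 r 0 0 a b 1 c.
Proof. by rewrite /model -lock ?(scale0r, scale1r, addr0, add0r). Qed.
Lemma L23_model p r m : L23 p r m = model p 0 r m 0 0 1 0 0.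
Proof. by rewrite /model -lock ?(scale0r, scale1r, addr0, add0r). Qed.

(** * Incomplete algebras *)
Lemma center_neq0_incomplete (g : homSuperalgebra V) x :
  x \in center g -> x != 0 -> ~ complete g.
Proof. by move=> xZ x0 [Z0 _]; move: xZ; rewrite Z0 memv0 (negPf x0). Qed.

Lemma delta_neq0 i : delta_mx i 0 != 0 :> V.
Proof.
by apply/eqP => /colP/(_ i)/eqP; rewrite !mxE !eqxx oner_eq0.
Qed.

(** Both sides of the Leibniz rule vanish: the map kills all brackets, since
    these have no e2-component, and the right-hand side at x, y is a multiple
    of [v, w] + [w, v] = 0, where w is the twist of e2. The equation on v says
    that the map commutes with the twist. *)
Lemma e2_column_Der p q r s B D v :
    v 2 0 = 0 -> v 1 0 * B = D * v 0 0 ->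
  Der (model p q r s 0 0 B D 0) 1 (endo_of_cols 0 v 0).
Proof.
move=> v2 comm; apply: even_map_Der.
- by apply: endo_of_cols_even; rewrite ?col0_coord.
- move=> x; apply: col3_eq; rewrite !coordE ?v2; [|by ring..].
  transitivity (x 1 0 * (D * v 0 0)); first by ring.
  by rewrite -comm; ring.
- move=> x y; rewrite !twistXE /=.
  by apply: col3_eq; rewrite !coordE ?v2; ring.
Qed.

Lemma Inn_coord0 (g : homSuperalgebra V) k x i f :
  (forall y, ad g k y x i 0 = 0) -> Inn g k f -> f x i 0 = 0.
Proof.
move=> ad0; apply: (Inn_ind (P := fun h => h x i 0 = 0)) => [|c G H G0 H0|_ y _ _].
- by rewrite zero_lfunE col0_coord.
- by rewrite add_lfunE scale_lfunE colD_coord colZ_coord G0 H0 mulr0 addr0.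
- exact: ad0.
Qed.

(** Applying the twist multiplies the e2-coordinate by D, so this coordinate is 0
    for a fixed vector; the rest of a fixed vector is killed by the twist.
    Hence no vector but 0 is fixed and no map but 0 is inner. *)
Lemma no_fixed_point_incomplete p q r s B D :
  D != 1 -> ~ complete (model p q r s 0 0 B D 0).
Proof.
move=> D1 /complete_Der_Inn cpl.
(* In both cases v commutes as required in [e2_column_Der]: for B != 0 it is the
   twist of e2, so that the derivation is the twist itself; that would be 0 for
   B = D = 0, but when B = 0 the vector e2 is an eigenvector. *)
pose v : V := if B == 0 then e2 F else B *: e1 F + D *: e2 F.
have v0 : v != 0.
  rewrite /v; case: (eqVneq B 0) => [_|B0]; first exact: delta_neq0.
  apply/eqP => /colP/(_ 0)/eqP; rewrite !coordE /= mulr0 addr0 mulr1.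
  by rewrite (negPf B0).
have /cpl innD : Der (model p q r s 0 0 B D 0) 1 (endo_of_cols 0 v 0).
  by apply: e2_column_Der; rewrite /v; case: (eqVneq B 0) => [B0|_];
    rewrite ?{1}B0 !coordE /=; ring.
have /lfunP/(_ (e2 F)) : endo_of_cols 0 v 0 = 0.
  move: innD; apply: (Inn_ind (P := fun h => h = 0)) => // [c G H -> ->|i x _ fx].
    by rewrite scaler0 addr0.
  suff -> : x = 0 by rewrite /ad linear0 comp_lfun0l.
  have x1 : x 1 0 = 0.
    by apply: (mulr_fixed_eq0 D1); rewrite -{2}fx model_twist1.
  by apply: col3_eq; rewrite -fx !coordE ?x1; ring.
rewrite zero_lfunE => De2; case/eqP: v0; rewrite -[RHS]De2.
by apply: col3_eq; rewrite !coordE /=; ring.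
Qed.

(** The projection to e2 is not inner: no bracket has an e2-component. *)
Lemma twist_diag010_incomplete p q r s :
  ~ complete (model p q r s 0 0 0 1 0).
Proof.
move=> /complete_Der_Inn cpl.
have /cpl/(Inn_coord0 (x := e2 F) (i := 1)) :
    Der (model p q r s 0 0 0 1 0) 1 (endo_of_cols 0 (e2 F) 0).
  by apply: e2_column_Der; rewrite !coordE /=; ring.
rewrite !coordE /= => De2.
have /eqP : 1 = 0 :> F.
  by rewrite -[RHS]De2 => [|y]; rewrite ?comp_lfunE ?coordE; ring.
by rewrite oner_eq0.
Qed.

(** The weight 2a of e2 is forced by the bracket [e3, e3] = e2: with weight 1 on
    e3, the Leibniz rule of level 1 gives [e3, a e3] + [a e3, e3] = 2a e2. *)
Lemma L9_incomplete a : ~ complete (L9 a).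
Proof.
rewrite L9_model => /complete_Der_Inn cpl.
have /cpl/(Inn_coord0 (x := e3 F) (i := 2)) : Der (model 1 0 0 0 1 0 0 (a ^+ 2) a) 1
    (endo_of_cols 0 ((2%:R * a) *: e2 F) (e3 F)).
  apply: even_map_Der.
  - by apply: endo_of_cols_even; rewrite !coordE //= mulr0.
  - by move=> x; apply: col3_eq; rewrite !coordE /=; ring.
  - by move=> x y; rewrite !twistXE /=; apply: col3_eq; rewrite !coordE /=; ring.
rewrite !coordE /= => De3.
have /eqP : 1 = 0 :> F.
  by rewrite -[RHS]De3 => [|y]; rewrite ?comp_lfunE ?coordE; ring.
by rewrite oner_eq0.
Qed.

(** The map ad_x of level 0 has e1-entry -p u at e1 and e3-entry r u at e3, where
    u is the e2-coordinate of x. The functional [P] vanishes on such maps, but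
    its value at the projection to e3 is p. *)
Lemma e1_weight_incomplete p r A B E : p != 0 ->
  ~ complete (model p 0 r 0 0 A B 1 E).
Proof.
move=> p0 /complete_Der_Inn cpl.
have /cpl innD : Der (model p 0 r 0 0 A B 1 E) 1 (endo_of_cols 0 0 (e3 F)).
  apply: even_map_Der.
  - by apply: endo_of_cols_even; rewrite !coordE.
  - by move=> x; apply: col3_eq; rewrite !coordE /=; ring.
  - by move=> x y; rewrite !twistXE /=; apply: col3_eq; rewrite !coordE /=; ring.
pose P (f : 'End(V)) := r * f (e1 F) 0 0 + p * f (e3 F) 2 0 = 0.
have : P (endo_of_cols 0 0 (e3 F)).
  move: innD; apply: Inn_ind => [|c G H G0 H0|i x _ _]; rewrite /P.
  - by rewrite !zero_lfunE !coordE; ring.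
  - rewrite !add_lfunE !scale_lfunE !coordE.
    transitivity (c * 0 + 0 : F); last by ring.
    by rewrite -{1}G0 -H0; ring.
  - by rewrite !comp_lfunE !id_lfunE !coordE /=; ring.
rewrite /P !coordE /= !(mulr0, mulr1, add0r, addr0) => /eqP.
by rewrite (negPf p0).
Qed.

(** * The family of complete algebras *)
Section L12.
Variable a : F.
Notation g := (model 1 1 0 0 0 a 0 1 0).
Notation E11 := (endo_of_cols (e1 F) 0 0).

Lemma L12_twistX0 k x : twistX g k x 0 0 = a ^+ k * x 0 0.
Proof.
rewrite twistXE; elim: k => [|k IHk] /=; first by ring.
by rewrite model_twist0 IHk exprS; ring.
Qed.

Lemma L12_twistX1 k x : twistX g k x 1 0 = x 1 0.
Proof.
by rewrite twistXE; elim: k => [|k IHk] //=; rewrite model_twist1 IHk mulr1.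
Qed.

Lemma L12_twistX2 k x : twistX g k x 2 0 = (if k is 0%N then x 2 0 else 0).
Proof. by rewrite twistXE; case: k => //= k; rewrite model_twist2 mulr0. Qed.

Definition L12E := (L12_twistX0, L12_twistX1, L12_twistX2, coordE).

(** On [e1, e3] = e3 the Leibniz rule of level n for the projection to e3 reads
    e3 = a ^+ n *: e3. The hypothesis n > 1 makes the level n - 1 of the inner
    maps positive, and a positive power of the twist kills e3. *)
Lemma L12_root_of_unity_incomplete n : (1 < n)%N -> a ^+ n = 1 ->
  ~ complete (L12 a).
Proof.
case: n => [|[|n]] // _ an1; rewrite L12_model => /complete_Der_Inn cpl.
have /cpl/(Inn_coord0 (x := e3 F) (i := 2)) : Der g n.+2 (endo_of_cols 0 0 (e3 F)).
  apply: even_map_Der.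
  - by apply: endo_of_cols_even; rewrite !coordE.
  - by move=> x; apply: col3_eq; rewrite !coordE /=; ring.
  - by move=> x y; apply: col3_eq; rewrite !L12E /= ?an1; ring.
rewrite !coordE /= => De3.
have /eqP : 1 = 0 :> F.
  by rewrite -[RHS]De3 => [|y]; rewrite ?comp_lfunE ?L12E /=; ring.
by rewrite oner_eq0.
Qed.

Lemma L12_ad_e2 k : ad g k (e2 F) = - a ^+ k *: E11.
Proof.
apply: endo_eq; rewrite scale_lfunE comp_lfunE; apply: col3_eq;
  by rewrite !L12E /=; case: k => [|k] /=; ring.
Qed.

Lemma L12_fixed x : a != 1 -> twist g x = x -> x = x 1 0 *: e2 F.
Proof.
move=> a1 fx; apply: col3_eq; rewrite !coordE /= ?mulr0 ?mulr1 //.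
  by apply: (mulr_fixed_eq0 a1); rewrite -{2}fx model_twist0; ring.
by rewrite -fx model_twist2 mulr0.
Qed.

Lemma L12_Inn k f : a != 0 -> a != 1 -> Inn g k f <-> exists c, f = c *: E11.
Proof.
move=> a0 a1; split.
  apply: (Inn_ind (P := fun h => exists c, h = c *: E11))
      => [|c G H [d ->] [e ->]|i x _ /(L12_fixed a1) ->].
  - by exists 0; rewrite scale0r.
  - by exists (c * d + e); rewrite scalerA scalerDl.
  - exists (- (x 1 0 * a ^+ k)); rewrite /ad linearZ /= -comp_lfunZl -/(ad g k _).
    by rewrite L12_ad_e2 scalerA mulrN.
case=> c ->; exists [:: e2 F] => [x|].
  rewrite inE => /eqP->; split.
    by exists false; apply/model_partP; rewrite e2_coord.
  by apply: col3_eq; rewrite !coordE /=; ring.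
rewrite /= span_seq1 L12_ad_e2; apply/vlineP; exists (- (c / a ^+ k)).
by rewrite scalerA mulrNN divfK // expf_neq0.
Qed.

(** The level is positive because the rule on [e1, e3], whose left-hand side is
    0, needs the power of the twist to kill e3. *)
Lemma L12_E11_Der k c : Der g k.+1 (c *: E11).
Proof.
have -> : c *: E11 = endo_of_cols (c *: e1 F) 0 0.
  by apply: endo_eq; rewrite scale_lfunE; apply: col3_eq; rewrite !coordE /=; ring.
apply: even_map_Der.
- by apply: endo_of_cols_even; rewrite !coordE //= mulr0.
- by move=> x; apply: col3_eq; rewrite !coordE /=; ring.
- by move=> x y; apply: col3_eq; rewrite !L12E /=; ring.
Qed.

(** The twist is diagonal with the distinct eigenvalues a, 1 and 0. *)
Lemma L12_commutant (f : 'End(V)) : a != 0 -> a != 1 ->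
    (forall x, f (twist g x) = twist g (f x)) ->
  [/\ f (e1 F) = f (e1 F) 0 0 *: e1 F, f (e2 F) = f (e2 F) 1 0 *: e2 F &
      f (e3 F) = f (e3 F) 2 0 *: e3 F].
Proof.
move=> a0 a1 com.
have te1 : twist g (e1 F) = a *: e1 F by apply: col3_eq; rewrite !coordE /=; ring.
have te2 : twist g (e2 F) = e2 F by apply: col3_eq; rewrite !coordE /=; ring.
have te3 : twist g (e3 F) = 0 by apply: col3_eq; rewrite !coordE /=; ring.
have a_inj u : a * u = 0 -> u = 0.
  by move/eqP; rewrite mulf_eq0 (negPf a0) => /eqP.
split.
- have c1 i : a * f (e1 F) i 0 = twist g (f (e1 F)) i 0.
    by rewrite -com te1 linearZ colZ_coord.
  apply: col3_eq; rewrite !coordE /= ?mulr1 ?mulr0 //.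
    by apply: (mulr_fixed_eq0 a1); rewrite mulrC c1 model_twist1 mulr1.
  by apply: a_inj; rewrite c1 model_twist2 mulr0.
- by apply: L12_fixed; rewrite // -com te2.
- have c3 : twist g (f (e3 F)) = 0 by rewrite -com te3 linear0.
  have c3i i : twist g (f (e3 F)) i 0 = 0 by rewrite c3 col0_coord.
  apply: col3_eq; rewrite !coordE /= ?mulr1 ?mulr0 //.
    by apply: a_inj; have := c3i 0; rewrite model_twist0 mulr0 addr0 mulrC.
  by have := c3i 1; rewrite model_twist1 mulr1.
Qed.

(** An odd map commuting with the twist is at the same time diagonal, hence 0.
    On the even part, with diagonal entries d1, d2, d3, the Leibniz rule on
    [e1, e2] = e1 gives a ^+ k.+1 * d2 = 0, and the rule on [e1, e3] = e3 gives
    d3 = a ^+ k.+1 * d3. *)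
Lemma L12_Der k f : a != 0 -> a != 1 -> a ^+ k.+1 != 1 ->
  Der g k.+1 f <-> exists c, f = c *: E11.
Proof.
move=> a0 a1 ak; split=> [|[c ->]]; last exact: L12_E11_Der.
case=> D0 [D1 [[_ com0 der0] [odd1 com1 _] ->]].
have e1P : e1 F \in part g false by apply/model_partP; rewrite e1_coord.
have e2P : e2 F \in part g false by apply/model_partP; rewrite e2_coord.
have e3P : e3 F \in part g true by apply/model_partP; rewrite !e3_coord.
have b12 : br g (e1 F) (e2 F) = e1 F by apply: col3_eq; rewrite !coordE /=; ring.
have b13 : br g (e1 F) (e3 F) = e3 F by apply: col3_eq; rewrite !coordE /=; ring.
have D1_0 : D1 = 0.
  have [d1 d2 d3] := L12_commutant a0 a1 com1.
  have /model_partP[o1 _] := odd1 _ _ e1P; have /model_partP[_ o2] := odd1 _ _ e2P.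
  have /model_partP o3 := odd1 _ _ e3P.
  rewrite o1 scale0r in d1; rewrite o2 scale0r in d2; rewrite o3 scale0r in d3.
  by apply: endo_eq; rewrite zero_lfunE ?d1 ?d2 ?d3.
have [d1 d2 d3] := L12_commutant a0 a1 com0.
have d2_0 : D0 (e2 F) 1 0 = 0.
  have := congr1 (fun y : V => y 0 0) (der0 _ _ _ _ e1P e2P).
  rewrite b12 mul0n scale1r !L12E /= => h.
  have /eqP : a ^+ k.+1 * D0 (e2 F) 1 0 = 0.
    transitivity (D0 (e1 F) 0 0 - D0 (e1 F) 0 0); last by ring.
    by rewrite {1}h; ring.
  by rewrite mulf_eq0 expf_eq0 (negPf a0) andbF => /eqP.
have d3_0 : D0 (e3 F) 2 0 = 0.
  have := congr1 (fun y : V => y 2 0) (der0 _ _ _ _ e1P e3P).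
  rewrite b13 mul0n scale1r !L12E /= => h.
  by apply: (mulr_fixed_eq0 ak); rewrite [RHS]h; ring.
exists (D0 (e1 F) 0 0); rewrite D1_0 addr0.
apply: endo_eq; rewrite scale_lfunE.
- by rewrite {1}d1; apply: col3_eq; rewrite !coordE /=; ring.
- by rewrite d2 d2_0; apply: col3_eq; rewrite !coordE /=; ring.
- by rewrite d3 d3_0; apply: col3_eq; rewrite !coordE /=; ring.
Qed.

Lemma L12_complete : a != 0 -> (forall k, (1 <= k)%N -> a ^+ k != 1) ->
  complete (L12 a).
Proof.
move=> a0 ak; have a1 : a != 1 by have := ak 1%N isT; rewrite expr1.
rewrite L12_model; split; last first.
  by move=> k f; rewrite L12_Der ?L12_Inn //; exact: ak.
apply/eqP; rewrite -subv0; apply/subvP => x /centerP xZ; rewrite memv0.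
have [c1 c2] : br g x (e1 F) = 0 /\ br g x (e2 F) = 0 by rewrite !xZ.
apply/eqP/col3_eq; rewrite col0_coord.
- by rewrite -(col0_coord 0) -c2 !coordE /=; ring.
- by rewrite -[RHS]oppr0 -(col0_coord 0) -c1 !coordE /=; ring.
- by rewrite -[RHS]oppr0 -(col0_coord 2) -c1 !coordE /=; ring.
Qed.

End L12.

(** * The classification *)
Lemma listed_complete_L12 (g : homSuperalgebra V) : listed g -> complete g ->
  exists a, [/\ g = L12 a, a != 0 & forall k, (1 <= k)%N -> a ^+ k != 1].
Proof.
have nonzero Z x h : with_center Z h -> x \in Z -> x != 0 -> ~ complete h.
  by case=> _ _ <-; apply: center_neq0_incomplete.
have nzl (p r : F) : p * r != 0 -> p != 0.
  by apply: contraNneq => ->; rewrite mul0r.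
case=> {g} [g /nonzero inc|g /nonzero inc|g /nonzero inc|g /nonzero inc
  |g /nonzero inc||a _||a a1|a a1|p r a pr _|p r pr|p r a b pr b1
  |p r a b pr _|p r a b c pr _|p r m _].
- by case/(inc (e1 F)); rewrite ?memvf ?delta_neq0.
- by case/(inc (e1 F)); rewrite ?memv_span ?mem_head ?delta_neq0.
- by case/(inc (e3 F)); rewrite ?memv_line ?delta_neq0.
- by case/(inc (e1 F)); rewrite ?memv_line ?delta_neq0.
- by case/(inc (e2 F)); rewrite ?memv_line ?delta_neq0.
- by rewrite L6_model => /no_fixed_point_incomplete[]; rewrite eq_sym oner_eq0.
- by move/L9_incomplete.
- by rewrite L10_model => /twist_diag010_incomplete.
- by rewrite L11_model => /no_fixed_point_incomplete[].
- move=> cpl; exists a; split=> // [|k k0]; apply/negP => /eqP ak.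
    by move: cpl; rewrite L12_model ak => /twist_diag010_incomplete.
  case: k k0 ak => [|[|k]] // _; first by rewrite expr1 => ak; rewrite ak eqxx in a1.
  by move/L12_root_of_unity_incomplete; apply.
- by rewrite L16_model => /e1_weight_incomplete[]; apply: nzl pr.
- by rewrite L17_model => /e1_weight_incomplete[]; apply: nzl pr.
- by rewrite L18_model => /no_fixed_point_incomplete[].
- by rewrite L19_model => /e1_weight_incomplete[]; apply: nzl pr.
- by rewrite L20_model => /e1_weight_incomplete[]; apply: nzl pr.
- by rewrite L23_model => /no_fixed_point_incomplete[]; rewrite eq_sym oner_eq0.
Qed.

End Models.

Theorem theorem4p7 (R : realType) :
  (forall g : homSuperalgebra 'cV[R[i]]_3,
     listed g /\ complete g <->
     exists a : R[i],
       [/\ g = L12 a, a != 0 & forall k : nat, (1 <= k)%N -> a ^+ k != 1])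
  /\ (forall a : R[i],
        (a != 0 /\ forall k : nat, (1 <= k)%N -> a ^+ k != 1) <->
        (a != 0 /\ ~ is_root_of_unity a)).
Proof.
split=> [g|a].
  split=> [[lg cg]|[a [-> a0 ak]]]; first exact: listed_complete_L12.
  split; last exact: L12_complete.
  by apply: In_L12; have := ak 1%N isT; rewrite expr1.
split=> -[a0 ak]; split=> //.
  by case=> n n0; rewrite unity_rootE => an; have := ak n n0; rewrite an.
move=> k k0; apply/negP => ak1; apply: ak; exists k => //.
by rewrite unity_rootE.
Qed.
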